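(* Let $K$ be a compact Hausdorff space of infinite cardinality, and let $s_0\in K$ be an accumulation point of a countably infinite subset of $K$. (i) The set $$X=\bigl\{f\in C(K): f\!\upharpoonright_U\text{ is constant for some neighbourhood }U\text{ of }s_0\bigr\}$$ is a proper, dense sublattice of $C(K)$ and thus Archimedean, and $X$ is finitely uniformly complete, but not uniformly complete. (ii) The set $$J=\bigl\{f\in C(K): f\!\upharpoonright_U=0\text{ for some neighbourhood }U\text{ of }s_0\bigr\}$$ is an order ideal of $C(K)$; it is not closed, and the quotient $Z=C(K)/J$ is a non-Archimedean vector lattice which admits a positively homogeneous continuous function calculus $\boldsymbol{z}\mapsto\Phi_{\boldsymbol{z}}$ that satisfies $$\Phi_{(\Phi_{\boldsymbol{z}}(f_1),\ldots,\Phi_{\boldsymbol{z}}(f_m))}(g)=\Phi_{\boldsymbol{z}}\bigl(g\circ(f_1\times\cdots\times f_m)\bigr)$$ for each $m,n\in\mathbb{N}$, $\boldsymbol{z}\in Z^n$, $f_1,\ldots,f_m\in H_n$ and $g\in H_m$, where $f_1\times\cdots\times f_m\colon\mathbb{R}^n\to\mathbb{R}^m$ is defined by $(f_1\times\cdots\times f_m)(t)=(f_1(t),\ldots,f_m(t))$.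
   Context: All vector spaces and vector lattices are over $\mathbb{R}$, and $\mathbb{N}=\{1,2,\ldots\}$. Sublattices are linear sublattices (closed under linear operations and $\vee,\wedge$), and a vector lattice homomorphism is a linear map preserving $\vee$ and $\wedge$. $C(K)$ is the Banach lattice of continuous real-valued functions on $K$ with pointwise operations and the supremum norm $\|\cdot\|_\infty$; ''dense'' and ''closed'' refer to this norm. The quotient of a vector lattice by an order ideal carries the quotient vector lattice structure. A vector lattice $X$ is Archimedean if, whenever $x,y\in X^+$ satisfy $nx\le y$ for each $n\in\mathbb{N}$, it follows that $x=0$. For a vector lattice $X$ and $e\in X^+$, let $I_e=\{x\in X: |x|\le\lambda e\text{ for some }\lambda\in[0,\infty)\}$ be the order ideal generated by $e$, and let $\|x\|_e=\inf\{\lambda\in[0,\infty): |x|\le\lambda e\}$ for $x\in I_e$; this is a norm on $I_e$ when $X$ is Archimedean. An Archimedean vector lattice $X$ is uniformly complete if, for each positive $e\in X$, $I_e$ is complete with respect to $\|\cdot\|_e$. It is finitely uniformly complete if, for each $n\in\mathbb{N}$ and $x_1,\ldots,x_n\in X$, there is a positive element $e\in X$ such that $e\ge|x_1|\vee\cdots\vee|x_n|$ and the norm $\|\cdot\|_e$ is complete on the closed sublattice of $(I_e,\|\cdot\|_e)$ generated by $x_1,\ldots,x_n$. A function $f\colon\mathbb{R}^n\to\mathbb{R}$ is positively homogeneous if $f(\lambda t)=\lambda f(t)$ for each $\lambda\in[0,\infty)$ and $t\in\mathbb{R}^n$. $H_n$ denotes the vector lattice (with pointwise operations) of positively homogeneous,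 continuous functions $\mathbb{R}^n\to\mathbb{R}$, and $\pi_i^{(n)}\in H_n$ is the $i$-th coordinate projection. A positively homogeneous continuous function calculus for a vector lattice $Z$ is a map $\boldsymbol{z}\mapsto\Phi_{\boldsymbol{z}}$ assigning to each $n\in\mathbb{N}$ and each $\boldsymbol{z}=(z_1,\ldots,z_n)\in Z^n$ a vector lattice homomorphism $\Phi_{\boldsymbol{z}}\colon H_n\to Z$ such that $\Phi_{\boldsymbol{z}}(\pi_i^{(n)})=z_i$ for $i\in\{1,\ldots,n\}$. *)

(* Defs.v *)
From HB Require Import structures.
From mathcomp Require Import all_boot all_order all_algebra.
From mathcomp Require Import all_classical all_reals all_analysis.

Set Implicit Arguments.
Unset Strict Implicit.
Unset Printing Implicit Defensive.

Import Order.TTheory GRing.Theory Num.Theory.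
Import numFieldNormedType.Exports.

Local Open Scope classical_set_scope.
Local Open Scope quotient_scope.
Local Open Scope ring_scope.

(* Join and meet are fields here, and not those of Order.Lattice, because
   Hierarchy Builder accepts no join of Order.Lattice with GRing.Zmodule below
   the already declared Num.RealDomain. *)
HB.mixin Record isVectorLattice (R : realType) V
    of GRing.Lmodule R V & Num.POrderedZmodule V := {
  vjoin : V -> V -> V ;
  vmeet : V -> V -> V ;
  levD2r : forall z x y : V, x <= y -> x + z <= y + z ;
  scalev_ge0 : forall (a : R) (x : V), 0 <= a -> 0 <= x -> 0 <= a *: x ;
  vjoin_le : forall x y z : V, (vjoin x y <= z) = (x <= z) && (y <= z) ;
  le_vmeet : forall x y z : V, (z <= vmeet x y) = (z <= x) && (z <= y)
}.

#[short(type="vectorLatticeType")]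
HB.structure Definition VectorLattice (R : realType) :=
  {V of GRing.Lmodule R V & Num.POrderedZmodule V & isVectorLattice R V}.

Definition vabs {R : realType} {V : vectorLatticeType R} (x : V) : V :=
  vjoin x (- x).

Section VectorLatticeTheory.
Context {R : realType} {V : vectorLatticeType R}.
Implicit Types x y z : V.

Lemma levD2rE z x y : (x + z <= y + z) = (x <= y).
Proof.
apply/idP/idP => [/(levD2r (- z))|]; last exact: levD2r.
by rewrite !addrK.
Qed.

Lemma levD2lE z x y : (z + x <= z + y) = (x <= y).
Proof. by rewrite ![z + _]addrC levD2rE. Qed.

Lemma levD x y z t : x <= y -> z <= t -> x + z <= y + t.
Proof. by move=> xy zt; apply: le_trans (levD2r _ _ _ xy) _; rewrite levD2lE. Qed.

Lemma subv_ge0 x y : (0 <= y - x) = (x <= y).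
Proof. by rewrite -(levD2rE x 0 (y - x)) subrK add0r. Qed.

Lemma levN2 x y : (- x <= - y) = (y <= x).
Proof. by rewrite -[LHS]subv_ge0 opprK addrC subv_ge0. Qed.

Lemma lev_joinl x y : x <= vjoin x y.
Proof. by have := lexx (vjoin x y); rewrite vjoin_le => /andP[]. Qed.

Lemma lev_joinr x y : y <= vjoin x y.
Proof. by have := lexx (vjoin x y); rewrite vjoin_le => /andP[]. Qed.

Lemma vmeet_lel x y : vmeet x y <= x.
Proof. by have := lexx (vmeet x y); rewrite le_vmeet => /andP[]. Qed.

Lemma vmeet_ler x y : vmeet x y <= y.
Proof. by have := lexx (vmeet x y); rewrite le_vmeet => /andP[]. Qed.

Lemma lev_vabs x : x <= vabs x.
Proof. exact: lev_joinl. Qed.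

Lemma levN_vabs x : - x <= vabs x.
Proof. exact: lev_joinr. Qed.

Lemma vabs_ge0 x : 0 <= vabs x.
Proof.
have : 0 <= vabs x + vabs x by rewrite -(subrr x) levD ?lev_vabs ?levN_vabs.
move=> /(@scalev_ge0 R V 2^-1); rewrite invr_ge0 ler0n => /(_ isT).
by rewrite scalerDr -scalerDl -[2^-1]mul1r -splitr scale1r.
Qed.

Lemma ger0_vabs x : 0 <= x -> vabs x = x.
Proof.
move=> x0; apply/eqP; rewrite eq_le lev_vabs andbT vjoin_le lexx/=.
by apply: (le_trans _ x0); rewrite -[leRHS]oppr0 levN2.
Qed.

End VectorLatticeTheory.

Section Substructures.
Context {R : realType} {V : vectorLatticeType R}.

Definition sublattice (A : set V) : Prop :=
  [/\ A 0,
      forall (a : R) x y, A x -> A y -> A (a *: x + y),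
      forall x y, A x -> A y -> A (vjoin x y) &
      forall x y, A x -> A y -> A (vmeet x y)].

Definition order_ideal (J : set V) : Prop :=
  [/\ J 0,
      forall (a : R) x y, J x -> J y -> J (a *: x + y) &
      forall x y, J y -> vabs x <= vabs y -> J x].

End Substructures.

Definition vlhom {R : realType} {V W : vectorLatticeType R} (f : V -> W) : Prop :=
  [/\ linear f,
      forall x y, f (vjoin x y) = vjoin (f x) (f y) &
      forall x y, f (vmeet x y) = vmeet (f x) (f y)].

Section SublatticeType.
Context {R : realType} {V : vectorLatticeType R}.
Variables (A : set V) (hA : sublattice A).

(* The proof [hA] is kept as a parameter of the type, for the instances below. *)
Definition subvl : Type := let _ := hA in {x : V | x \in A}.

HB.instance Definition _ :=
  [isSub of subvl for (@sval V (fun x => x \in A) : subvl -> V)].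
HB.instance Definition _ := [Choice of subvl by <:].

Fact subvl_subsemimod_closed : GRing.subsemimod_closed (fun x => x \in A).
Proof.
case: hA => A0 AL _ _; split=> [|a x]; first split; rewrite /in_mem/= ?inE//.
- move=> x y; rewrite /in_mem/= !inE => Ax Ay.
  by rewrite -[x]scale1r; exact: AL.
- by move=> Ax; rewrite -[_ *: _]addr0; exact: AL.
Qed.

HB.instance Definition _ :=
  GRing.SubChoice_isSubLmodule.Build R V (fun x => x \in A) subvl
    subvl_subsemimod_closed.
HB.instance Definition _ :=
  Order.SubChoice_isSubPOrder.Build ring_display V (fun x => x \in A)
    ring_display subvl.

Fact subvl_join_subproof (x y : subvl) : vjoin (val x) (val y) \in A.
Proof.
by case: hA => _ _ AU _; rewrite inE; apply: AU; apply/set_mem; exact: valP.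
Qed.

Fact subvl_meet_subproof (x y : subvl) : vmeet (val x) (val y) \in A.
Proof.
by case: hA => _ _ _ AI; rewrite inE; apply: AI; apply/set_mem; exact: valP.
Qed.

Definition subvl_join (x y : subvl) : subvl :=
  exist (fun v => v \in A) _ (subvl_join_subproof x y).
Definition subvl_meet (x y : subvl) : subvl :=
  exist (fun v => v \in A) _ (subvl_meet_subproof x y).

Lemma subvl_leE (x y : subvl) : (x <= y) = (val x <= val y).
Proof. by []. Qed.

Fact subvl_leD2r (z x y : subvl) : x <= y -> x + z <= y + z.
Proof. by rewrite !subvl_leE !raddfD; exact: levD2r. Qed.

Fact subvl_scale_ge0 (a : R) (x : subvl) : 0 <= a -> 0 <= x -> 0 <= a *: x.
Proof. by rewrite !subvl_leE raddf0 linearZ; exact: scalev_ge0. Qed.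

Fact subvl_join_le (x y z : subvl) :
  (subvl_join x y <= z) = (x <= z) && (y <= z).
Proof. by rewrite !subvl_leE vjoin_le. Qed.

Fact subvl_le_meet (x y z : subvl) :
  (z <= subvl_meet x y) = (z <= x) && (z <= y).
Proof. by rewrite !subvl_leE le_vmeet. Qed.

HB.instance Definition _ := isVectorLattice.Build R subvl
  subvl_leD2r subvl_scale_ge0 subvl_join_le subvl_le_meet.

End SublatticeType.

Section ContinuousFunctions.
Context {R : realType} {T : topologicalType}.
Local Notation CT := (continuousType T R).
Implicit Types f g h : CT.

Definition cts_zero : CT := mkcts (@cst_continuous T R 0).

Fact cts_opp_subproof f : continuous (fun x => - f x : R).
Proof. by move=> x; apply: cvgN; exact: cts_fun. Qed.
Definition cts_opp f : CT := mkcts (@cts_opp_subproof f).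

Fact cts_add_subproof f g : continuous (fun x => f x + g x : R).
Proof. by move=> x; apply: cvgD; exact: cts_fun. Qed.
Definition cts_add f g : CT := mkcts (@cts_add_subproof f g).

Fact cts_scale_subproof (a : R) f : continuous (fun x => a * f x : R).
Proof. by move=> x; apply: cvgMr; exact: cts_fun. Qed.
Definition cts_scale a f : CT := mkcts (@cts_scale_subproof a f).

Fact cts_join_subproof f g : continuous (fun x => Num.max (f x) (g x) : R).
Proof. by move=> x; apply: continuous_max; exact: cts_fun. Qed.
Definition cts_join f g : CT := mkcts (@cts_join_subproof f g).

Fact cts_meet_subproof f g : continuous (fun x => Num.min (f x) (g x) : R).
Proof. by move=> x; apply: continuous_min; exact: cts_fun. Qed.
Definition cts_meet f g : CT := mkcts (@cts_meet_subproof f g).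

Fact cts_addA : associative cts_add.
Proof. by move=> f g h; apply/continuousEP => x; exact: addrA. Qed.
Fact cts_addC : commutative cts_add.
Proof. by move=> f g; apply/continuousEP => x; exact: addrC. Qed.
Fact cts_add0 : left_id cts_zero cts_add.
Proof. by move=> f; apply/continuousEP => x; exact: add0r. Qed.
Fact cts_addN : left_inverse cts_zero cts_opp cts_add.
Proof. by move=> f; apply/continuousEP => x; exact: addNr. Qed.

HB.instance Definition _ :=
  GRing.isZmodule.Build CT cts_addA cts_addC cts_add0 cts_addN.

Fact cts_scaleA a b f : cts_scale a (cts_scale b f) = cts_scale (a * b) f.
Proof. by apply/continuousEP => x; exact: mulrA. Qed.
Fact cts_scale1 : left_id 1 cts_scale.
Proof. by move=> f; apply/continuousEP => x; exact: mul1r. Qed.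
Fact cts_scaleDr : right_distributive cts_scale +%R.
Proof. by move=> a f g; apply/continuousEP => x; exact: mulrDr. Qed.
Fact cts_scaleDl f : {morph cts_scale^~ f : a b / a + b}.
Proof. by move=> a b; apply/continuousEP => x; exact: mulrDl. Qed.

HB.instance Definition _ := GRing.Zmodule_isLmodule.Build R CT
  cts_scaleA cts_scale1 cts_scaleDr cts_scaleDl.

Definition cts_le f g : bool := `[< forall x, f x <= g x >].

Fact cts_le_refl : reflexive cts_le.
Proof. by move=> f; apply/asboolP. Qed.
Fact cts_le_anti : antisymmetric cts_le.
Proof.
move=> f g /andP[/asboolP fg /asboolP gf]; apply/continuousEP => x.
by apply/eqP; rewrite eq_le fg gf.
Qed.
Fact cts_le_trans : transitive cts_le.
Proof.
move=> g f h /asboolP fg /asboolP gh; apply/asboolP => x.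
exact: le_trans (fg x) (gh x).
Qed.

HB.instance Definition _ := Order.Le_isPOrder.Build ring_display CT
  cts_le_refl cts_le_anti cts_le_trans.

Lemma ctsleP f g : reflect (forall x, f x <= g x) (f <= g).
Proof. exact: asboolP. Qed.

Fact cts_leD2r h f g : f <= g -> f + h <= g + h.
Proof. by move=> /ctsleP fg; apply/ctsleP => x; rewrite lerD2r. Qed.
Fact cts_scale_ge0 (a : R) f : 0 <= a -> 0 <= f -> 0 <= a *: f.
Proof. by move=> a0 /ctsleP f0; apply/ctsleP => x; exact: (mulr_ge0 a0 (f0 x)). Qed.
Lemma cts_joinE f g x : cts_join f g x = Num.max (f x) (g x).
Proof. by []. Qed.
Lemma cts_meetE f g x : cts_meet f g x = Num.min (f x) (g x).
Proof. by []. Qed.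
Fact cts_join_le f g h : (cts_join f g <= h) = (f <= h) && (g <= h).
Proof.
apply/ctsleP/andP => [fgh|[/ctsleP fh /ctsleP gh] x].
  by split; apply/ctsleP => x; have := fgh x; rewrite cts_joinE ge_max => /andP[].
by rewrite cts_joinE ge_max fh gh.
Qed.
Fact cts_le_meet f g h : (h <= cts_meet f g) = (h <= f) && (h <= g).
Proof.
apply/ctsleP/andP => [fgh|[/ctsleP fh /ctsleP gh] x].
  by split; apply/ctsleP => x; have := fgh x; rewrite cts_meetE le_min => /andP[].
by rewrite cts_meetE le_min fh gh.
Qed.

HB.instance Definition _ := isVectorLattice.Build R CT
  cts_leD2r cts_scale_ge0 cts_join_le cts_le_meet.

End ContinuousFunctions.

Section QuotientVL.
Context {R : realType} {V : vectorLatticeType R}.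
Variables (J : set V) (hJ : order_ideal J).

Definition ideal_pred : {pred V} := let _ := hJ in fun x => x \in J.

Lemma ideal_predP x : reflect (J x) (x \in ideal_pred).
Proof. exact: (iffP idP set_mem mem_set). Qed.

Fact ideal_pred_zmod_closed : GRing.zmod_closed ideal_pred.
Proof.
case: (hJ) => J0 JL _; split=> [|x y /ideal_predP Jx /ideal_predP Jy].
  exact/ideal_predP.
by apply/ideal_predP; rewrite addrC -scaleN1r; exact: JL.
Qed.

HB.instance Definition _ :=
  GRing.isZmodClosed.Build V ideal_pred ideal_pred_zmod_closed.

Definition quotvl : Type := Quotient.quot ideal_pred.

HB.instance Definition _ := GRing.Zmodule.on quotvl.
HB.instance Definition _ := EqQuotient.on quotvl.

Implicit Types (x y z : V) (a b c : quotvl).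

Definition quotvl_pi : V -> quotvl := \pi_quotvl.

Lemma quotvl_piP a : exists x, quotvl_pi x = a.
Proof. by exists (repr a); exact: reprK. Qed.

Lemma quotvl_piE x y : quotvl_pi x = quotvl_pi y <-> J (x - y).
Proof.
rewrite (rwP eqP) -[_ == _]/(x == y %[mod Quotient.quot ideal_pred]).
by rewrite -Quotient.idealrBE; split => /ideal_predP.
Qed.

Lemma quotvl_piD x y : quotvl_pi (x + y) = quotvl_pi x + quotvl_pi y.
Proof. exact: (raddfD \pi_(Quotient.quot ideal_pred)). Qed.

Definition quotvl_scale (k : R) a : quotvl := quotvl_pi (k *: repr a).

Lemma quotvl_piZ k x : quotvl_scale k (quotvl_pi x) = quotvl_pi (k *: x).
Proof.
apply/quotvl_piE; case: (hJ) => J0 JL _.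
rewrite -scalerBr -[_ *: _]addr0; apply: JL => //.
by apply/quotvl_piE; exact: reprK.
Qed.

Fact quotvl_scaleA (k l : R) a :
  quotvl_scale k (quotvl_scale l a) = quotvl_scale (k * l) a.
Proof. by have [x <-] := quotvl_piP a; rewrite !quotvl_piZ scalerA. Qed.
Fact quotvl_scale1 : left_id 1 quotvl_scale.
Proof. by move=> a; have [x <-] := quotvl_piP a; rewrite quotvl_piZ scale1r. Qed.
Fact quotvl_scaleDr : right_distributive quotvl_scale +%R.
Proof.
move=> k a b; have [x <-] := quotvl_piP a; have [y <-] := quotvl_piP b.
by rewrite -quotvl_piD !quotvl_piZ scalerDr quotvl_piD.
Qed.
Fact quotvl_scaleDl a : {morph quotvl_scale^~ a : k l / k + l}.
Proof.
move=> k l; have [x <-] := quotvl_piP a.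
by rewrite !quotvl_piZ scalerDl quotvl_piD.
Qed.

HB.instance Definition _ := GRing.Zmodule_isLmodule.Build R quotvl
  quotvl_scaleA quotvl_scale1 quotvl_scaleDr quotvl_scaleDl.

(* The positive cone of the quotient is the image of the positive cone of V. *)
Definition quotvl_le a b : bool :=
  `[< exists x y, [/\ quotvl_pi x = a, quotvl_pi y = b & x <= y] >].

Lemma quotvl_leP x y :
  reflect (exists2 j, J j & x <= y + j) (quotvl_le (quotvl_pi x) (quotvl_pi y)).
Proof.
case: (hJ) => J0 JL _; apply: (iffP (asboolP _)).
  move=> [x' [y' [/esym/quotvl_piE Jx /quotvl_piE Jy xy]]].
  exists ((x - x') + (y' - y)).
    by rewrite -[x - x']scale1r; exact: JL.
  have -> : y + ((x - x') + (y' - y)) = (x - x') + y'.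
    by rewrite addrCA [y + _]addrC subrK.
  by rewrite -[leLHS](subrK x') levD2lE.
move=> [j Jj xy]; exists x, (y + j); split=> //.
by apply/quotvl_piE; rewrite addrC addKr.
Qed.

Fact quotvl_le_refl : reflexive quotvl_le.
Proof.
move=> a; have [x <-] := quotvl_piP a; apply/asboolP.
by exists x, x.
Qed.

Lemma ideal_between j x k : J j -> J k -> j <= x -> x <= k -> J x.
Proof.
case: (hJ) => J0 JL JS Jj Jk jx xk.
have Ja z : J z -> J (vabs z).
  by move=> Jz; apply: (JS _ _ Jz); rewrite (ger0_vabs (vabs_ge0 z)).
have Jjk : J (vabs j + vabs k).
  by rewrite -[vabs j]scale1r; apply: JL; apply: Ja.
apply: (JS _ _ Jjk); rewrite [vabs (_ + _)]ger0_vabs; last first.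
  by rewrite -[leLHS]addr0; apply: levD; exact: vabs_ge0.
rewrite vjoin_le; apply/andP; split.
  rewrite -[leLHS]add0r; apply: levD; first exact: vabs_ge0.
  exact: le_trans xk (lev_vabs _).
rewrite -[leLHS]addr0; apply: levD; last exact: vabs_ge0.
by apply: le_trans (levN_vabs j); rewrite levN2.
Qed.

Fact quotvl_le_anti : antisymmetric quotvl_le.
Proof.
move=> a b; have [x <-] := quotvl_piP a; have [y <-] := quotvl_piP b.
move=> /andP[/quotvl_leP[j Jj xy] /quotvl_leP[k Jk yx]].
apply/quotvl_piE; case: (hJ) => J0 JL _.
apply: (@ideal_between (- k) _ j) => //.
- by rewrite -[- k]addr0 -scaleN1r; exact: JL.
- by rewrite -(levD2rE (y + k)) addrCA addNr addr0 addrA subrK.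
- by rewrite -(levD2rE y) subrK addrC.
Qed.

Fact quotvl_le_trans : transitive quotvl_le.
Proof.
move=> b a c; have [x <-] := quotvl_piP a; have [y <-] := quotvl_piP b.
have [z <-] := quotvl_piP c => /quotvl_leP[j Jj xy] /quotvl_leP[k Jk yz].
apply/quotvl_leP; exists (k + j).
  by case: (hJ) => _ JL _; rewrite -[k]scale1r; exact: JL.
by apply: le_trans xy _; rewrite addrA levD2rE.
Qed.

HB.instance Definition _ := Order.Le_isPOrder.Build ring_display quotvl
  quotvl_le_refl quotvl_le_anti quotvl_le_trans.

Definition quotvl_join a b : quotvl := quotvl_pi (vjoin (repr a) (repr b)).
Definition quotvl_meet a b : quotvl := quotvl_pi (vmeet (repr a) (repr b)).

Lemma quotvl_le_pi x y : x <= y -> quotvl_pi x <= quotvl_pi y.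
Proof. by move=> xy; apply/asboolP; exists x, y. Qed.

Lemma quotvl_lePi x y :
  reflect (exists2 j, J j & x <= y + j) (quotvl_pi x <= quotvl_pi y).
Proof. exact: quotvl_leP. Qed.

Fact quotvl_leD2r c a b : a <= b -> a + c <= b + c.
Proof.
have [x <-] := quotvl_piP a; have [y <-] := quotvl_piP b.
have [z <-] := quotvl_piP c => /quotvl_lePi[j Jj xy].
rewrite -!quotvl_piD; apply/quotvl_lePi; exists j => //.
by rewrite addrAC levD2rE.
Qed.

Fact quotvl_scale_ge0 (k : R) a : 0 <= k -> 0 <= a -> 0 <= k *: a.
Proof.
have [x <-] := quotvl_piP a => k0.
rewrite -[k *: _]/(quotvl_scale _ _) quotvl_piZ.
have <- : quotvl_pi 0 = 0 by exact: (raddf0 \pi_(Quotient.quot ideal_pred)).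
move=> /quotvl_lePi[j Jj xj]; apply/quotvl_lePi; exists (k *: j).
  by case: (hJ) => J0 JL _; rewrite -[_ *: _]addr0; exact: JL.
by rewrite -scalerDr; exact: scalev_ge0.
Qed.

Lemma ideal_common_bound j k : J j -> J k ->
  exists i, [/\ J i, j <= i & k <= i].
Proof.
case: (hJ) => _ JL JS Jj Jk; exists (vabs j + vabs k).
have Ja i : J i -> J (vabs i).
  by move=> Ji; apply: (JS _ _ Ji); rewrite (ger0_vabs (vabs_ge0 i)).
split; first by rewrite -[vabs j]scale1r; apply: JL; apply: Ja.
- by rewrite -[leLHS]addr0; apply: levD; [exact: lev_vabs|exact: vabs_ge0].
- by rewrite -[leLHS]add0r; apply: levD; [exact: vabs_ge0|exact: lev_vabs].
Qed.

Lemma quotvl_pi_join_le x y z : (quotvl_pi (vjoin x y) <= quotvl_pi z) =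
  (quotvl_pi x <= quotvl_pi z) && (quotvl_pi y <= quotvl_pi z).
Proof.
apply/idP/andP => [xyz|[/quotvl_lePi[j Jj xz] /quotvl_lePi[k Jk yz]]].
  by split; apply: le_trans xyz; apply: quotvl_le_pi;
    [exact: lev_joinl|exact: lev_joinr].
have [i [Ji ji ki]] := ideal_common_bound Jj Jk.
apply/quotvl_lePi; exists i => //; rewrite vjoin_le.
by rewrite (le_trans xz) ?levD2lE//= (le_trans yz) ?levD2lE.
Qed.

Lemma quotvl_pi_le_meet x y z : (quotvl_pi z <= quotvl_pi (vmeet x y)) =
  (quotvl_pi z <= quotvl_pi x) && (quotvl_pi z <= quotvl_pi y).
Proof.
apply/idP/andP => [zxy|[/quotvl_lePi[j Jj zx] /quotvl_lePi[k Jk zy]]].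
  by split; apply: (le_trans zxy); apply: quotvl_le_pi;
    [exact: vmeet_lel|exact: vmeet_ler].
have [i [Ji ji ki]] := ideal_common_bound Jj Jk.
apply/quotvl_lePi; exists i => //; rewrite -(levD2rE (- i)) addrK le_vmeet.
rewrite -![_ - i <= _](levD2rE i) subrK.
by rewrite (le_trans zx) ?levD2lE//= (le_trans zy) ?levD2lE.
Qed.

Fact quotvl_join_le a b c : (quotvl_join a b <= c) = (a <= c) && (b <= c).
Proof.
rewrite -[c]reprK [LHS]quotvl_pi_join_le.
by rewrite -{2}[a]reprK -{2}[b]reprK.
Qed.

Fact quotvl_le_meet a b c : (c <= quotvl_meet a b) = (c <= a) && (c <= b).
Proof.
rewrite -[c]reprK [LHS]quotvl_pi_le_meet.
by rewrite -{2}[a]reprK -{2}[b]reprK.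
Qed.

HB.instance Definition _ := isVectorLattice.Build R quotvl
  quotvl_leD2r quotvl_scale_ge0 quotvl_join_le quotvl_le_meet.

Lemma quotvl_pi_vlhom : vlhom quotvl_pi.
Proof.
split=> [k x y|x y|x y].
- by rewrite quotvl_piD -quotvl_piZ.
- apply: le_anti; apply/andP; split; last first.
    by rewrite vjoin_le; apply/andP; split; apply: quotvl_le_pi;
      [exact: lev_joinl|exact: lev_joinr].
  have [w ww] := quotvl_piP (vjoin (quotvl_pi x) (quotvl_pi y)).
  by rewrite -ww quotvl_pi_join_le ww lev_joinl lev_joinr.
- apply: le_anti; apply/andP; split.
    by rewrite le_vmeet; apply/andP; split; apply: quotvl_le_pi;
      [exact: vmeet_lel|exact: vmeet_ler].
  have [w ww] := quotvl_piP (vmeet (quotvl_pi x) (quotvl_pi y)).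
  by rewrite -ww quotvl_pi_le_meet ww vmeet_lel vmeet_ler.
Qed.

End QuotientVL.

Section UniformCompleteness.
Context {R : realType} {V : vectorLatticeType R}.
Implicit Types (x y e : V) (A D : set V) (N : V -> R).

Definition archimedean : Prop :=
  forall x y, 0 <= x -> 0 <= y ->
    (forall n, (0 < n)%N -> x *+ n <= y) -> x = 0.

Definition principal_ideal e : set V :=
  [set x | exists2 l : R, 0 <= l & vabs x <= l *: e].

(* Meaningful on [principal_ideal e] only: elsewhere it is [inf set0 = 0]. *)
Definition order_unit_norm e x : R :=
  inf [set l : R | 0 <= l /\ vabs x <= l *: e].

(* Closure, density, closedness in a subspace [D] and completeness of a subset
   for the metric [N (x - y)]; [N] is only required to be a norm on the
   subspace of interest, so the topology of [V] is not used. *)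
Definition norm_closure N A : set V :=
  [set x | forall eps : R, 0 < eps -> exists2 y, A y & N (x - y) < eps].

Definition norm_dense N A : Prop := norm_closure N A = setT.

Definition norm_closed_in N D A : Prop := D `&` norm_closure N A `<=` A.

Definition norm_cauchy N (u : nat -> V) : Prop :=
  forall eps : R, 0 < eps -> exists n0 : nat,
    forall m n, (n0 <= m)%N -> (n0 <= n)%N -> N (u m - u n) < eps.

Definition norm_complete N A : Prop :=
  forall u : nat -> V, (forall k, A (u k)) -> norm_cauchy N u ->
    exists2 l, A l & (fun k => N (u k - l)) @ \oo --> (0 : R).

Definition uniformly_complete : Prop :=
  archimedean /\
  forall e, 0 <= e -> norm_complete (order_unit_norm e) (principal_ideal e).

Definition closed_sublattice_generated e n (x : 'I_n -> V) : set V :=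
  [set y | forall A, sublattice A -> A `<=` principal_ideal e ->
     norm_closed_in (order_unit_norm e) (principal_ideal e) A ->
     (forall i, A (x i)) -> A y].

(* [e] bounds every [vabs (x i)], i.e. it is above their finite join. *)
Definition finitely_uniformly_complete : Prop :=
  archimedean /\
  forall n (x : 'I_n -> V), (0 < n)%N ->
    exists e, [/\ 0 <= e, forall i, vabs (x i) <= e &
      norm_complete (order_unit_norm e) (closed_sublattice_generated e x)].

End UniformCompleteness.

Arguments archimedean {R} V.
Arguments uniformly_complete {R} V.
Arguments finitely_uniformly_complete {R} V.

Definition sup_norm {R : realType} {K : topologicalType}
    (f : continuousType K R) : R :=
  sup [set `|f x| | x in [set: K]].

Section PositivelyHomogeneous.
Context {R : realType}.

Definition pos_homogeneous n : set (continuousType 'rV[R]_n R) :=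
  [set f | forall (l : R) t, 0 <= l -> f (l *: t) = l * f t].

Fact pos_homogeneous_sublattice n : sublattice (@pos_homogeneous n).
Proof.
split=> [l t _|a f g hf hg l t l0|f g hf hg l t l0|f g hf hg l t l0].
- by rewrite /= mulr0.
- have E s : (a *: f + g) s = a * f s + g s by [].
  by rewrite !E hf// hg// mulrDr mulrCA.
- by rewrite !cts_joinE hf// hg// maxr_pMr.
- by rewrite !cts_meetE hf// hg// minr_pMr.
Qed.

Definition Hfun n : Type := subvl (@pos_homogeneous_sublattice n).

Definition Happ n (f : Hfun n) : 'rV[R]_n -> R := (sval f : continuousType _ _).

Lemma Happ_continuous n (f : Hfun n) : continuous (Happ f).
Proof. exact: cts_fun. Qed.

Lemma Happ_homogeneous n (f : Hfun n) (l : R) t :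
  0 <= l -> Happ f (l *: t) = l * Happ f t.
Proof. by move=> l0; apply: (set_mem (proj2_sig f)). Qed.

Definition Hfun_of n (f : 'rV[R]_n -> R) (fc : continuous f)
    (fh : forall (l : R) t, 0 <= l -> f (l *: t) = l * f t) : Hfun n :=
  exist (fun h => h \in @pos_homogeneous n) (mkcts fc : continuousType _ _)
    (mem_set fh).

Fact Hproj_continuous n (i : 'I_n) : continuous (fun t : 'rV[R]_n => t ord0 i).
Proof. exact: coord_continuous. Qed.

Fact Hproj_homogeneous n (i : 'I_n) (l : R) (t : 'rV[R]_n) :
  0 <= l -> (l *: t) ord0 i = l * t ord0 i.
Proof. by rewrite mxE. Qed.

Definition Hproj n (i : 'I_n) : Hfun n :=
  Hfun_of (@Hproj_continuous n i) (@Hproj_homogeneous n i).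

Definition Hprod m n (f : 'I_m -> Hfun n) (t : 'rV[R]_n) : 'rV[R]_m :=
  \row_i Happ (f i) t.

Fact Hcomp_continuous m n (g : Hfun m) (f : 'I_m -> Hfun n) :
  continuous (Happ g \o Hprod f).
Proof.
move=> t; apply: continuous_comp; last exact: Happ_continuous.
move=> A [P nP PA].
have nf i : nbhs t [set s | P ord0 i (Happ (f i) s)].
  by apply: Happ_continuous; have := nP ord0 i; rewrite mxE.
have FF : Filter (nbhs t) := @nbhs_filter 'rV[R]_n t.
apply: (@filterS _ (nbhs t) FF) (@filter_forall _ _ _ (nbhs t) FF nf) => s Ps.
by apply: PA => i j; rewrite mxE ord1; exact: Ps.
Qed.

Fact Hcomp_homogeneous m n (g : Hfun m) (f : 'I_m -> Hfun n) (l : R) t :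
  0 <= l -> (Happ g \o Hprod f) (l *: t) = l * (Happ g \o Hprod f) t.
Proof.
move=> l0 /=; rewrite -Happ_homogeneous//; congr (Happ g _).
by apply/rowP => i; rewrite !mxE Happ_homogeneous.
Qed.

Definition Hcomp m n (g : Hfun m) (f : 'I_m -> Hfun n) : Hfun n :=
  Hfun_of (@Hcomp_continuous m n g f) (@Hcomp_homogeneous m n g f).

(* The values at [n = 0] are unconstrained: the index set is {1, 2, ...}. *)
Definition function_calculus {Z : vectorLatticeType R}
    (Phi : forall n, ('I_n -> Z) -> Hfun n -> Z) : Prop :=
  forall n (z : 'I_n -> Z), (0 < n)%N ->
    vlhom (Phi n z) /\ forall i, Phi n z (Hproj i) = z i.

End PositivelyHomogeneous.

Arguments Hfun : clear implicits.

Definition locally_constant_at (R : realType) (K : topologicalType) (s0 : K) :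
    set (continuousType K R) :=
  [set f | exists2 U, nbhs s0 U & exists c : R, forall x, U x -> f x = c].

Definition locally_zero_at (R : realType) (K : topologicalType) (s0 : K) :
    set (continuousType K R) :=
  [set f | exists2 U, nbhs s0 U & forall x, U x -> f x = 0].

Arguments locally_constant_at : clear implicits.
Arguments locally_zero_at : clear implicits.

(* Main.v *)
Require Import Defs.
From mathcomp Require Import all_boot all_order all_algebra.
From mathcomp Require Import all_classical all_reals all_analysis.
From mathcomp Require Import lra.
Import Order.TTheory GRing.Theory Num.Theory.
Import numFieldNormedType.Exports.
Local Open Scope classical_set_scope.
Local Open Scope ring_scope.

(** Everything rests on one function.  Urysohn's lemma gives, for every point [t]
    of [S] other than [s0], a continuous function that vanishes at [s0] and not
    at [t]; as [S] is countable, a weighted supremum of these is a uniform limit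
    of finite suprema, hence a continuous [g >= 0] with [g s0 = 0] and [g > 0] on
    [S] minus [s0].  As [s0] is an accumulation point of [S], [g] is constant on
    no neighbourhood of [s0] ([exists_nonconstant_germ]).

    Conversely every continuous [f] is a uniform limit of functions constant near
    [s0]: subtract from [f] the truncation of [f - f s0] between [- eps] and
    [eps] ([flatten_near]).  So [X] is dense, and it is proper because of [g]; if
    [f s0 = 0] the approximants even lie in [J], so that [g] is in the closure of
    [J] but not in [J].

    Completeness of [X] can be tested with constant functions [M > 0] as order
    units: by compactness they generate the whole of [X], and their norm is the
    supremum norm up to the factor [M].  A sequence in [X] converging uniformly
    to [g] shows that [X] is not uniformly complete.  Finitely many elements of
    [X], however, are constant on a common neighbourhood [N] of [s0].  Being
    constant on [N] is preserved by lattice operations and uniform limits, so it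
    passes to the closed sublattice they generate, and uniform limits of
    sequences in that sublattice remain in [X].

    As to [Z], for every [n] the inequality [n g <= 1] holds near [s0], so the
    nonzero class of [g] is infinitesimal with respect to that of [1].  The
    calculus on [Z] comes from the pointwise one on [C(K)], which sends [z] and
    [f] to [f] composed with [(z_1, ..., z_n)].  Near [s0] the composite depends
    only on the values of the [z_i] near [s0], so it descends to the quotient,
    and the composition law descends with it. *)

(** * Order unit norms and closed sublattices *)

Section VectorLattices.
Context {R : realType} {V : vectorLatticeType R}.
Implicit Types (x y e : V) (A : set V).

Lemma archimedean_sublattice {A} (hA : sublattice A) :
  archimedean V -> archimedean (subvl hA).
Proof.
move=> aV x y x0 y0 xy; apply: val_inj; rewrite raddf0.
apply: (aV _ (val y)) => // n n0.
by rewrite -raddfMn -subvl_leE; exact: xy.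
Qed.

Lemma order_unit_norm_ge0 e x : 0 <= order_unit_norm e x.
Proof.
rewrite /order_unit_norm; set L := [set l | _].
have [->|/set0P L0] := eqVneq L set0; first by rewrite inf0.
by apply: lb_le_inf => // l [].
Qed.

Lemma order_unit_normN e x : order_unit_norm e (- x) = order_unit_norm e x.
Proof.
suff E : vabs (- x) = vabs x by rewrite /order_unit_norm E.
by apply/le_anti; rewrite /vabs !vjoin_le !opprK !lev_joinl !lev_joinr.
Qed.

Lemma order_unit_norm_le e x (l : R) :
  0 <= l -> vabs x <= l *: e -> order_unit_norm e x <= l.
Proof. by move=> l0 xl; apply: ge_inf; [exists 0 => ? []|split]. Qed.

(** The infimum defining the norm need not be attained without the Archimedean
    property; a strict upper bound always gives an inequality in the lattice. *)
Lemma order_unit_norm_lt e x (l : R) : 0 <= e -> principal_ideal e x ->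
  order_unit_norm e x < l -> vabs x <= l *: e.
Proof.
move=> e0 [k k0 xk] /inf_lt[|r [r0 xr] rl]; first by exists k.
apply: le_trans xr _; rewrite -subv_ge0 -scalerBl.
by apply: scalev_ge0 => //; rewrite subr_ge0 ltW.
Qed.

Lemma vlhom_comp {U W : vectorLatticeType R} (f : U -> V) (g : V -> W) :
  vlhom f -> vlhom g -> vlhom (g \o f).
Proof.
move=> [fL fU fI] [gL gU gI]; split=> [a x y|x y|x y] /=.
- by rewrite fL gL.
- by rewrite fU gU.
- by rewrite fI gI.
Qed.

Lemma closed_sublattice_generated_sub {e n} {x : 'I_n -> V} {A} :
  sublattice A -> A `<=` principal_ideal e ->
  norm_closed_in (order_unit_norm e) (principal_ideal e) A ->
  (forall i, A (x i)) -> closed_sublattice_generated e x `<=` A.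
Proof. by move=> sA Ae cA Ax y; exact. Qed.

Lemma closed_sublattice_generated_closed e n (x : 'I_n -> V) :
  norm_closed_in (order_unit_norm e) (principal_ideal e)
    (closed_sublattice_generated e x).
Proof.
move=> y [ye yx] A sA Ae cA Ax; apply: (cA) => //; split => // eps eps0.
by have [z /(_ A sA Ae cA Ax) Az yz] := yx _ eps0; exists z.
Qed.

End VectorLattices.

(** * The lattice of continuous functions *)

Section ContinuousFunctionSpace.
Context {R : realType} {K : topologicalType}.
Local Notation CK := (continuousType K R).
Implicit Types (f g h : CK) (x : K).

Lemma archimedean_cts : archimedean CK.
Proof.
move=> f g /ctsleP f0 /ctsleP g0 fg; apply/continuousEP => x.
apply/eqP; rewrite eq_le f0 andbT leNgt; apply/negP => fx0.
have [n ngt] : exists n : nat, g x / f x < n%:R.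
  exists (Num.bound (g x / f x)); apply: archi_boundP.
  by apply: divr_ge0; [exact: g0|exact: f0].
have := fg n.+1 isT; rewrite -scaler_nat => /ctsleP/(_ x) nfg.
have {nfg} : n.+1%:R * f x <= g x by exact: nfg.
rewrite -ler_pdivlMr// leNgt => /negP; apply.
by apply: lt_trans ngt _; rewrite ltr_nat.
Qed.

Lemma vabs_ctsE f x : vabs f x = `|f x|.
Proof. by rewrite -[LHS]/(Num.max (f x) (- f x)) -maxrN. Qed.

Lemma compact_cts_bounded f : compact [set: K] ->
  exists M : R, forall x, `|f x| <= M.
Proof.
move=> cK; have [[x0 _]|K0] := pselect ([set: K] !=set0); last first.
  by exists 0 => x; case: K0; exists x.
have cf : {within [set: K], continuous (fun x => `|f x| : R)}.
  apply: continuous_subspaceT => x.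
  apply: (@continuous_comp _ _ _ f Num.norm); first exact: cts_fun.
  exact: norm_continuous.
have [|c _ fc] := compact_EVT_max _ cK cf; first by exists x0.
by exists `|f c| => x; apply: fc; rewrite in_setT.
Qed.

Lemma sup_norm_le {f} {M : R} (x0 : K) :
  (forall x, `|f x| <= M) -> sup_norm f <= M.
Proof.
move=> fM; apply: ge_sup; first by exists `|f x0|, x0.
by move=> _ [x _ <-].
Qed.

(** The pointwise limits exist since the reals are complete; the uniform bound
    passes to the limit and makes it continuous, by an [eps / 3] argument. *)
Lemma uniform_cauchy_limit (u : nat -> CK) :
  (forall eps : R, 0 < eps -> exists n0, forall m n, (n0 <= m)%N -> (n0 <= n)%N ->
    forall x, `|u m x - u n x| <= eps) ->
  exists f, forall eps : R, 0 < eps -> exists n0, forall n, (n0 <= n)%N ->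
    forall x, `|u n x - f x| <= eps.
Proof.
move=> cu; have cvu x : cvgn (fun n => u n x : R).
  apply: cauchy_cvg; apply: cauchy_exP => eps eps0.
  have [n0 un0] := cu (eps / 2) (divr_gt0 eps0 (ltr0Sn R 1)).
  exists (u n0 x); exists n0 => // n /= n0n.
  rewrite /ball/=; apply: le_lt_trans (un0 _ _ _ n0n x) _ => //.
  by rewrite ltr_pdivrMr// ltr_pMr// ltr1n.
pose f0 x : R := limn (fun n => u n x).
have uf eps : 0 < eps -> exists n0, forall n, (n0 <= n)%N ->
    forall x, `|u n x - f0 x| <= eps.
  move=> eps0; have [n0 un0] := cu _ eps0; exists n0 => n n0n x.
  have cd : (fun m => `|u n x - u m x| : R) @ \oo --> `|u n x - f0 x|.
    by apply: cvg_norm; apply: cvgB; [exact: cvg_cst|exact: cvu].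
  rewrite -(cvg_lim _ cd)//; apply: limr_le; first exact: (cvgP _ cd).
  by exists n0 => // m /= n0m; exact: un0.
have cf0 : continuous f0.
  move=> x; apply/cvgrPdist_le => eps eps0.
  have e3 : 0 < eps / 3 by rewrite divr_gt0.
  have [n0 /(_ n0 (leqnn _)) un0] := uf _ e3.
  have : \forall y \near x, `|u n0 x - u n0 y| <= eps / 3.
    by have /cvgrPdist_le := @cts_fun _ _ (u n0) x; apply.
  apply: filterS => y uxy; have := un0 x; have := un0 y; move: uxy.
  rewrite !ler_norml => /andP[? ?] /andP[? ?] /andP[? ?]; lra.
by exists (mkcts cf0); exact: uf.
Qed.

(** Urysohn's lemma for two points of a compact Hausdorff space.  The case [t = s]
    is allowed, so that one can separate [s] from all terms of a sequence without
    asking that they differ from [s]. *)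
Lemma separate_points (cK : compact [set: K]) (hK : hausdorff_space K) (s t : K) :
  exists f, [/\ f s = 0, forall x, 0 <= f x <= 1 & t != s -> f t = 1].
Proof.
have [->|ts] := eqVneq t s.
  by exists 0; split=> // x; rewrite -[(0 : CK) x]/(0 : R) lexx ler01.
have acc := hausdorff_accessible hK.
have : uniform_separator [set s] [set t].
  apply: normal_uniform_separator; first exact: compact_normal.
  - exact: accessible_closed_set1.
  - exact: accessible_closed_set1.
  - by apply/seteqP; split=> // x [/= -> ts']; rewrite ts' eqxx in ts.
move=> /(@uniform_separatorP _ R)[f [cf f01 fs ft]].
exists (mkcts cf); split=> [|x|_].
- by apply: fs; exists s.
- by have := f01 (f x); rewrite /= in_itv/=; apply; exists x.
- by apply: ft; exists t.
Qed.

End ContinuousFunctionSpace.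

(** * Functions near the point s0 *)

Section Germs.
Context {R : realType} {K : topologicalType} (s0 : K).
Local Notation CK := (continuousType K R).
Implicit Types (f g h : CK).

(** The constant value near [s0] can only be the value at [s0], which turns the
    property into a single filter condition. *)
Lemma locally_constant_atP f :
  locally_constant_at R K s0 f <-> \forall x \near s0, f x = f s0.
Proof.
split=> [[U nU [c fc]]|fs]; last first.
  by exists [set x | f x = f s0] => //; exists (f s0).
by apply: filterS (nU) => x Ux; rewrite !fc//; exact: nbhs_singleton.
Qed.

Lemma locally_zero_atP f :
  locally_zero_at R K s0 f <-> \forall x \near s0, f x = 0.
Proof.
split=> [[U nU f0]|f0]; last by exists [set x | f x = 0].
by apply: filterS nU => x /f0.
Qed.

Lemma sublattice_locally_constant_at : sublattice (locally_constant_at R K s0).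
Proof.
split=> [|a f g /locally_constant_atP fs /locally_constant_atP gs
         |f g /locally_constant_atP fs /locally_constant_atP gs
         |f g /locally_constant_atP fs /locally_constant_atP gs];
  apply/locally_constant_atP.
- exact: nearW.
- by apply: filterS2 fs gs => x fx gx; rewrite -[LHS]/(a * f x + g x) fx gx.
- by apply: filterS2 fs gs => x fx gx; rewrite -[LHS]/(Num.max (f x) (g x)) fx gx.
- by apply: filterS2 fs gs => x fx gx; rewrite -[LHS]/(Num.min (f x) (g x)) fx gx.
Qed.

Lemma order_ideal_locally_zero_at : order_ideal (locally_zero_at R K s0).
Proof.
split=> [|a f g /locally_zero_atP f0 /locally_zero_atP g0
         |f g /locally_zero_atP g0 /ctsleP fg]; apply/locally_zero_atP.
- exact: nearW.
- apply: filterS2 f0 g0 => x fx gx.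
  by rewrite -[LHS]/(a * f x + g x) fx gx mulr0 addr0.
- apply: filterS g0 => x gx; apply/eqP; rewrite -normr_le0.
  by rewrite -vabs_ctsE (le_trans (fg x))// vabs_ctsE gx normr0.
Qed.

(** Subtract from [f] the function [f - f s0] truncated between [- eps] and [eps]:
    this changes [f] by at most [eps], and where [f] is within [eps] of [f s0]
    the truncation has no effect, so that only the constant [f s0] is left. *)
Lemma flatten_near f {eps : R} : 0 < eps ->
  exists h, (\forall x \near s0, h x = f s0) /\ forall x, `|f x - h x| <= eps.
Proof.
move=> eps0; pose c : CK := mkcts (@cst_continuous K R (f s0)).
pose e : CK := mkcts (@cst_continuous K R eps).
exists (f - vmeet (vjoin (f - c) (- e)) e).
have E x : (f - vmeet (vjoin (f - c) (- e)) e) x =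
  f x - Num.min (Num.max (f x - f s0) (- eps)) eps by [].
split=> [|x]; last first.
  by rewrite E opprD addNKr opprK ler_norml ge_min le_min le_max !lexx !orbT/=; lra.
have /cvgrPdist_le/(_ _ eps0) : f x @[x --> s0] --> f s0 by exact: cts_fun.
apply: filterS => x; rewrite distrC ler_norml E => /andP[lo hi].
by rewrite (max_l lo) (min_l hi) opprB addrCA subrr addr0.
Qed.

(** With [e] an enumeration of [S] and [phi n] separating [s0] from [e n], the
    function is the supremum of the [phi n / (n + 1)].  The weights tend to [0],
    so the finite suprema [u n] are uniformly Cauchy: beyond rank [m] they grow
    by at most [1 / (m + 1)]. *)
Lemma exists_nonconstant_germ (S : set K) :
  compact [set: K] -> hausdorff_space K -> countable S -> limit_point S s0 ->
  exists g, [/\ g s0 = 0, 0 <= g & ~ locally_constant_at R K s0 g].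
Proof.
move=> cK hK cS Ss.
have [e eS] : exists e : nat -> K, set_surj [set: nat] S e.
  have [S0|[e]] := pfcard_geP cS; last by exists e; exact: surj.
  by have [y [_ + _]] := Ss _ filterT; rewrite S0.
have /choice[phi phiE] k := separate_points (R := R) cK hK s0 (e k).
pose u := fix u n : CK :=
  if n is m.+1 then vjoin (u m) (m.+1%:R^-1 *: phi m) else 0.
have uS n x : u n.+1 x = Num.max (u n x) (n.+1%:R^-1 * phi n x) by [].
have phi01 n x : 0 <= n.+1%:R^-1 * phi n x <= n.+1%:R^-1.
  have [_ /(_ x)/andP[p0 p1] _] := phiE n.
  by rewrite mulr_ge0 ?invr_ge0// ler_piMr ?invr_ge0.
have u_ge0 n x : 0 <= u n x.
  by elim: n => // n IH; rewrite uS le_max IH.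
have u_s0 n : u n s0 = 0.
  by elim: n => // n IH; have [p0 _ _] := phiE n; rewrite uS IH p0 mulr0 maxxx.
have u_mono m n x : (m <= n)%N -> u m x <= u n x.
  elim: n => [|n IH]; first by rewrite leqn0 => /eqP ->.
  by rewrite leq_eqVlt => /orP[/eqP ->//|/IH umn]; rewrite uS le_max umn.
have u_tail m n x : (m <= n)%N -> u n x <= u m x + m.+1%:R^-1.
  elim: n => [|n IH]; first by rewrite leqn0 => /eqP ->; rewrite lerDl invr_ge0.
  rewrite leq_eqVlt => /orP[/eqP ->|mn]; first by rewrite lerDl invr_ge0.
  rewrite uS ge_max IH//=; have /andP[_ /le_trans] := phi01 n x; apply.
  apply: (@le_trans _ _ m.+1%:R^-1); last by rewrite lerDr.
  by rewrite lef_pV2 ?posrE// ler_nat ltnS.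
have [|g gu] := uniform_cauchy_limit u.
  move=> eps eps0; have [n0 _ n0P] := near_infty_natSinv_lt (PosNum eps0).
  exists n0 => m n n0m n0n x; have /ltW/= := n0P n0 (leqnn _).
  have := u_tail _ _ x n0m; have := u_tail _ _ x n0n.
  have := u_mono _ _ x n0m; have := u_mono _ _ x n0n.
  rewrite ler_norml; move: (n0.+1%:R^-1) => d.
  move=> *; apply/andP; split; lra.
have g_ge x n : u n x <= g x.
  apply/ler_addgt0Pl => eps eps0; have [n0 /(_ (maxn n n0))] := gu _ eps0.
  rewrite leq_maxr => /(_ isT x); have := u_mono _ _ x (leq_maxl n n0).
  by rewrite ler_norml => ? /andP[? ?]; lra.
have g_s0 : g s0 = 0.
  apply/eqP; rewrite eq_le (g_ge s0 0%N) andbT.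
  apply/ler_addgt0Pl => eps eps0; have [n0 /(_ n0 (leqnn _) s0)] := gu _ eps0.
  by rewrite u_s0 ler_norml => /andP[? ?]; lra.
exists g; split=> //; first by apply/ctsleP => x; exact: (g_ge x 0%N).
move=> /locally_constant_atP/Ss[x [+ Sx]]; have [k _ <-] := eS x Sx.
rewrite g_s0 => ks0 gk.
have [_ _ /(_ ks0) pk] := phiE k; have := g_ge (e k) k.+1.
by rewrite gk uS pk mulr1 ge_max => /andP[_]; rewrite leNgt invr_gt0 ltr0Sn.
Qed.

End Germs.

(** * Completeness of the functions constant near s0 *)

Section LocallyConstantFunctions.
Context {R : realType} {K : topologicalType} (s0 : K).
Hypothesis K_compact : compact [set: K].
Local Notation CK := (continuousType K R).
Local Notation X := (subvl (@sublattice_locally_constant_at R K s0)).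
Implicit Types (f g h : CK) (x y : X).

Fact cst_locally_constant_at (M : R) :
  locally_constant_at R K s0 (mkcts (@cst_continuous K R M)).
Proof. by apply/locally_constant_atP; exact: nearW. Qed.

Definition cstX (M : R) : X :=
  exist (fun f => f \in locally_constant_at R K s0) _
    (mem_set (cst_locally_constant_at M)).

(** The norm defined by [cstX M] is the supremum norm divided by [M].  The next
    lemmas translate between the two without computing either norm: bounds,
    Cauchy sequences and convergence. *)
Lemma vabs_le_cstX x (l M : R) :
  vabs x <= l *: cstX M <-> forall t, `|val x t| <= l * M.
Proof.
rewrite vjoin_le; split=> [/andP[/ctsleP xl /ctsleP lx] t|xl].
  by rewrite ler_norml lerNl; apply/andP; split; [exact: lx|exact: xl].
by apply/andP; split; apply/ctsleP => t;
  have := xl t; rewrite ler_norml lerNl => /andP[].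
Qed.

Lemma cstX_ge0 (M : R) : 0 <= M -> 0 <= cstX M.
Proof. by move=> M0; apply/ctsleP. Qed.

(** This is where compactness enters: continuous functions are bounded. *)
Lemma principal_ideal_cstX (M : R) x : 0 < M -> principal_ideal (cstX M) x.
Proof.
move=> M0; have [B xB] := compact_cts_bounded (val x) K_compact.
exists (Num.max B 0 / M); first by rewrite divr_ge0 ?le_max ?lexx ?orbT// ltW.
by apply/vabs_le_cstX => t; rewrite divfK ?gt_eqF// le_max xB.
Qed.

Lemma norm_cstX_lt {M : R} {x} {l : R} : 0 < M ->
  order_unit_norm (cstX M) x < l -> forall t, `|val x t| <= l * M.
Proof.
move=> M0 xl; apply/vabs_le_cstX; apply: order_unit_norm_lt => //.
  exact/cstX_ge0/ltW.
exact: principal_ideal_cstX.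
Qed.

Lemma norm_cstX_le {M : R} {x} {l : R} : 0 < M -> 0 <= l ->
  (forall t, `|val x t| <= l) -> order_unit_norm (cstX M) x <= l / M.
Proof.
move=> M0 l0 xl; apply: order_unit_norm_le; first by rewrite divr_ge0// ltW.
by apply/vabs_le_cstX => t; rewrite divfK ?gt_eqF.
Qed.

Lemma norm_cstX_cauchy {M : R} (u : nat -> X) : 0 < M ->
  norm_cauchy (order_unit_norm (cstX M)) u <->
  forall eps : R, 0 < eps -> exists n0, forall m n, (n0 <= m)%N -> (n0 <= n)%N ->
    forall t, `|val (u m) t - val (u n) t| <= eps.
Proof.
move=> M0; split=> cu eps eps0.
  have [n0 un0] := cu (eps / M) (divr_gt0 eps0 M0).
  exists n0 => m n n0m n0n t.
  by have := norm_cstX_lt M0 (un0 _ _ n0m n0n) t; rewrite divfK ?gt_eqF.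
have e0 : 0 < eps * M / 2 by rewrite !divr_gt0// mulr_gt0.
have [n0 un0] := cu _ e0; exists n0 => m n n0m n0n.
have := norm_cstX_le (x := u m - u n) M0 (ltW e0) (un0 _ _ n0m n0n).
move=> /le_lt_trans; apply; rewrite mulrAC mulfK ?gt_eqF//.
by rewrite ltr_pdivrMr// ltr_pMr// ltr1n.
Qed.

Lemma norm_cstX_cvg {M : R} (u : nat -> X) (l : X) : 0 < M ->
  (fun k => order_unit_norm (cstX M) (u k - l)) @ \oo --> (0 : R) <->
  forall eps : R, 0 < eps -> exists n0, forall n, (n0 <= n)%N ->
    forall t, `|val (u n) t - val l t| <= eps.
Proof.
move=> M0; split=> [/cvgrPdist_lt ul eps eps0|ul].
  have [n0 _ un0] := ul (eps / M) (divr_gt0 eps0 M0).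
  exists n0 => n n0n t; have := un0 n n0n; rewrite /= sub0r normrN.
  move=> /(le_lt_trans (ler_norm _))/(norm_cstX_lt M0)/(_ t).
  by rewrite divfK ?gt_eqF.
apply/cvgrPdist_le => eps eps0.
have e0 : 0 < eps * M by rewrite mulr_gt0.
have [n0 un0] := ul _ e0; exists n0 => // n /= n0n.
have := norm_cstX_le (x := u n - l) M0 (ltW e0) (un0 _ n0n).
by rewrite sub0r normrN mulfK ?gt_eqF// ger0_norm// order_unit_norm_ge0.
Qed.

(** The closed sublattice generated by the [x i] lies in the set [A] of functions
    constant on the common neighbourhood [N] where all [x i] are; a uniform limit
    of functions in [A] is constant on [N], hence again an element of [X]. *)
Lemma locally_constant_finitely_uniformly_complete :
  finitely_uniformly_complete X.
Proof.
split; first exact: archimedean_sublattice archimedean_cts.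
move=> n x _.
have /choice[B xB] i := compact_cts_bounded (val (x i)) K_compact.
pose M := \big[Num.max/1]_i B i.
have M0 : 0 < M by apply: lt_le_trans ltr01 (bigmax_ge_id _ _ _ _).
pose N : set K := [set t | forall i, val (x i) t = val (x i) s0].
have nN : nbhs s0 N.
  apply: filter_forall => i; apply/locally_constant_atP/set_mem.
  exact: (valP (x i)).
pose A : set X := [set y : X | forall t, N t -> val y t = val y s0].
have sA : sublattice A.
  split=> [t Nt|a y z yA zA t Nt|y z yA zA t Nt|y z yA zA t Nt] //.
  - by rewrite -[LHS]/(a * val y t + val z t) yA ?zA.
  - by rewrite -[LHS]/(Num.max (val y t) (val z t)) yA ?zA.
  - by rewrite -[LHS]/(Num.min (val y t) (val z t)) yA ?zA.
(* [A] is closed under uniform limits, stated for [f] in C(K) since it is used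
   before the limit is known to lie in [X]. *)
have limA f : (forall eps : R, 0 < eps ->
    exists2 y, A y & forall t, `|f t - val y t| <= eps) ->
    forall t, N t -> f t = f s0.
  move=> fA t Nt; apply/eqP; rewrite -subr_eq0 -normr_le0.
  apply/ler_addgt0Pl => eps eps0; rewrite addr0.
  have e2 : 0 < eps / 2 by rewrite divr_gt0.
  have [y yA yf] := fA _ e2; have := yf t; have := yf s0.
  by rewrite (yA t Nt) !ler_norml => /andP[? ?] /andP[? ?]; apply/andP; split; lra.
exists (cstX M); split.
- exact/cstX_ge0/ltW.
- move=> i; rewrite -[cstX M]scale1r; apply/vabs_le_cstX => t; rewrite mul1r.
  exact: le_trans (xB i t) (le_bigmax _ _ i).
move=> u uG /(norm_cstX_cauchy _ M0)/(uniform_cauchy_limit (fun k => val (u k))).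
move=> [f uf].
have GA : closed_sublattice_generated (cstX M) x `<=` A.
  apply: closed_sublattice_generated_sub => //.
  - by move=> y _; exact: principal_ideal_cstX.
  - move=> y [_ yA] t Nt; apply: (limA (val y)) Nt => eps eps0.
    have [z zA yz] := yA (eps / M) (divr_gt0 eps0 M0); exists z => // s.
    by have := norm_cstX_lt M0 yz s; rewrite divfK ?gt_eqF.
  - by move=> i t; exact.
have fX : f \in locally_constant_at R K s0.
  apply/mem_set/locally_constant_atP; apply: filterS nN => t.
  apply: limA => eps eps0; have [n0 /(_ n0 (leqnn _)) un0] := uf _ eps0.
  by exists (u n0) => [|s]; [exact: GA|rewrite distrC].
pose l : X := exist (fun f => f \in locally_constant_at R K s0) f fX.
have ul : (fun k => order_unit_norm (cstX M) (u k - l)) @ \oo --> (0 : R).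
  exact/(norm_cstX_cvg _ _ M0).
exists l => //; apply: closed_sublattice_generated_closed; split.
  exact: principal_ideal_cstX.
move=> eps eps0; have /cvgrPdist_lt/(_ _ eps0)[k _ /(_ k (leqnn k))] := ul.
rewrite /= sub0r normrN => /(le_lt_trans (ler_norm _)) ukl.
by exists (u k); [exact: uG|rewrite -order_unit_normN opprB].
Qed.

(** Elements of [X] approximating [g] uniformly form a Cauchy sequence, whose limit
    in [X] could only be [g]. *)
Lemma locally_constant_not_uniformly_complete g :
  ~ locally_constant_at R K s0 g -> ~ uniformly_complete X.
Proof.
move=> gX [_ /(_ (cstX 1) (cstX_ge0 _ ler01)) cX]; apply: gX.
have /choice[h hE] k : exists h : X, forall t, `|g t - val h t| <= k.+1%:R^-1.
  have [//|h [hs gh]] := @flatten_near _ _ s0 g k.+1%:R^-1.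
  have hX : h \in locally_constant_at R K s0.
    apply/mem_set/locally_constant_atP; rewrite (nbhs_singleton hs).
    exact: hs.
  by exists (exist _ h hX).
have hg eps : 0 < eps ->
    exists n0, forall n, (n0 <= n)%N -> forall t, `|g t - val (h n) t| <= eps.
  move=> eps0; have [n0 _ n0P] := near_infty_natSinv_lt (PosNum eps0).
  by exists n0 => n n0n t; apply: le_trans (hE n t) (ltW (n0P n n0n)).
have [u ul] : exists2 l : X, principal_ideal (cstX 1) l &
    (fun k => order_unit_norm (cstX 1) (h k - l)) @ \oo --> (0 : R).
  apply: cX => [k|]; first exact: principal_ideal_cstX.
  apply/norm_cstX_cauchy => // eps eps0.
  have [n0 n0P] := hg _ (divr_gt0 eps0 (ltr0Sn R 1)).
  exists n0 => m n n0m n0n t; have := n0P _ n0m t; have := n0P _ n0n t.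
  by rewrite !ler_norml => /andP[? ?] /andP[? ?]; apply/andP; split; lra.
move=> /norm_cstX_cvg hu; have -> : g = val u; last exact/set_mem/(valP u).
apply/continuousEP => t; apply/eqP; rewrite -subr_eq0 -normr_le0.
apply/ler_addgt0Pl => eps eps0; rewrite addr0.
have e2 : 0 < eps / 2 by rewrite divr_gt0.
have [n1 /(_ _ (leq_maxl n1 _)) h1] := hu ltr01 _ e2.
have [n2 /(_ _ (leq_maxr _ n2)) h2] := hg _ e2.
have := h1 n2 t; have := h2 n1 t.
by rewrite !ler_norml => /andP[? ?] /andP[? ?]; apply/andP; split; lra.
Qed.

End LocallyConstantFunctions.

(** * Function calculus on germs *)

Section FunctionCalculus.
Context {R : realType} {K : topologicalType}.
Local Notation CK := (continuousType K R).

Fact cts_calculus_continuous {n} (z : 'I_n -> CK) (f : Hfun R n) :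
  continuous (fun t => Happ f (\row_i z i t) : R).
Proof.
move=> t; apply: (@continuous_comp _ _ _ (fun s => \row_i z i s) (Happ f));
  last exact: Happ_continuous.
move=> A [P nP PA].
have nz i : nbhs t [set s | P ord0 i (z i s)].
  by apply: (@cts_fun _ _ (z i)); have := nP ord0 i; rewrite mxE.
have : \forall s \near t, forall i, P ord0 i (z i s) by exact: filter_forall.
apply: filterS => s Ps.
by apply: PA => i j; rewrite mxE ord1; exact: Ps.
Qed.

Definition cts_calculus n (z : 'I_n -> CK) (f : Hfun R n) : CK :=
  mkcts (cts_calculus_continuous z f).

Lemma cts_calculusE {n} (z : 'I_n -> CK) f t :
  cts_calculus n z f t = Happ f (\row_i z i t).
Proof. by []. Qed.

Lemma cts_function_calculus : function_calculus cts_calculus.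
Proof.
move=> n z _; split=> [|i]; last first.
  by apply/continuousEP => t; rewrite cts_calculusE [LHS]mxE.
by split=> [a f g|f g|f g]; apply/continuousEP.
Qed.

(** On [C(K)] the composition law is associativity of composition of functions. *)
Lemma cts_calculus_comp {m n} (z : 'I_n -> CK) (f : 'I_m -> Hfun R n)
    (g : Hfun R m) :
  cts_calculus m (fun i => cts_calculus n z (f i)) g =
  cts_calculus n z (Hcomp g f).
Proof. exact/continuousEP. Qed.

Variable s0 : K.
Local Notation J_ideal := (@order_ideal_locally_zero_at R K s0).
Local Notation Z := (quotvl J_ideal).

Definition germ : CK -> Z := quotvl_pi J_ideal.

Lemma germ_vlhom : vlhom germ.
Proof. exact: quotvl_pi_vlhom. Qed.

Lemma germ_eqP f g : germ f = germ g <-> \forall t \near s0, f t = g t.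
Proof.
split=> [/quotvl_piE/locally_zero_atP|] fg.
  by apply: filterS fg => t /eqP; rewrite subr_eq0 => /eqP.
apply/quotvl_piE/locally_zero_atP; apply: filterS fg => t fg.
by rewrite -[LHS]/(f t - g t) fg subrr.
Qed.

(** The calculus is local: near [s0] it sees only the values of its arguments near
    [s0].  Hence it is well defined on the quotient. *)
Lemma germ_cts_calculus n (z w : 'I_n -> CK) f :
  (forall i, germ (z i) = germ (w i)) ->
  germ (cts_calculus n z f) = germ (cts_calculus n w f).
Proof.
move=> zw; apply/germ_eqP.
have {}zw i : \forall t \near s0, z i t = w i t by apply/germ_eqP.
have : \forall t \near s0, forall i, z i t = w i t by exact: filter_forall.
apply: filterS => t zwt; rewrite !cts_calculusE.
by congr (Happ f _); apply/rowP => i; rewrite !mxE.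
Qed.

Definition germ_calculus n (z : 'I_n -> Z) (f : Hfun R n) : Z :=
  germ (cts_calculus n (fun i => repr (z i)) f).

Lemma germ_calculusE n (z : 'I_n -> CK) f :
  germ_calculus n (germ \o z) f = germ (cts_calculus n z f).
Proof. by apply: germ_cts_calculus => i; exact: reprK. Qed.

Lemma germ_function_calculus : function_calculus germ_calculus.
Proof.
move=> n z n0; have [hom proj] := cts_function_calculus n (fun i => repr (z i)) n0.
split; first exact: vlhom_comp hom germ_vlhom.
by move=> i; rewrite /germ_calculus proj; exact: reprK.
Qed.

(** The chosen representative of [germ_calculus n z (f i)] may differ from
    [cts_calculus n z (f i)] away from [s0]; by locality, only the germ matters. *)
Lemma germ_calculus_comp m n (z : 'I_n -> Z) (f : 'I_m -> Hfun R n)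
    (g : Hfun R m) :
  germ_calculus m (fun i => germ_calculus n z (f i)) g =
  germ_calculus n z (Hcomp g f).
Proof.
pose zr j : CK := repr (z j).
rewrite [LHS](germ_calculusE m (fun i => cts_calculus n zr (f i))).
by rewrite cts_calculus_comp.
Qed.

Lemma germ0 : germ 0 = 0.
Proof. by apply: (addrI (germ 0)); rewrite -quotvl_piD !addr0. Qed.

(** Since [g] is continuous and vanishes at [s0], for every [n] the function [g]
    is below [1 / n] near [s0].  There [n g <= 1], while the class of [g] is not
    zero. *)
Lemma germ_not_archimedean (g : CK) : g s0 = 0 -> 0 <= g ->
  ~ locally_zero_at R K s0 g -> ~ archimedean Z.
Proof.
move=> gs0 g0 gJ aZ; apply: gJ.
have [germL _ _] := germ_vlhom.
have germZ (a : R) f : germ (a *: f) = a *: germ f.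
  by rewrite -[a *: f]addr0 germL germ0 addr0.
have /germ_eqP : germ g = germ 0.
  rewrite germ0; apply: (aZ _ (germ (mkcts (@cst_continuous K R 1)))).
  - by rewrite -germ0; exact: quotvl_le_pi.
  - by rewrite -germ0; apply: quotvl_le_pi; apply/ctsleP => t; exact: ler01.
  move=> n n0; pose one : CK := mkcts (@cst_continuous K R 1).
  rewrite -scaler_nat -germZ.
  (* The excess of [n g] over [1] vanishes where [g <= 1 / n], so it lies in J. *)
  apply/quotvl_lePi; exists (vjoin (n%:R *: g - one) 0); last first.
    by rewrite -(levD2rE (- one)) addrAC subrr add0r lev_joinl.
  apply/locally_zero_atP.
  have n1 : 0 < n%:R^-1 :> R by rewrite invr_gt0 ltr0n.
  have /cvgrPdist_le/(_ _ n1) : g t @[t --> s0] --> g s0 by exact: cts_fun.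
  apply: filterS => t; rewrite gs0 sub0r normrN => /(le_trans (ler_norm _)) gt.
  rewrite -[LHS]/(Num.max (n%:R * g t - 1) 0) max_r// subr_le0.
  by rewrite -ler_pdivlMl ?ltr0n// mulr1.
by move=> g00; apply/locally_zero_atP.
Qed.

End FunctionCalculus.

(** * Local constancy and local vanishing at an accumulation point *)

Theorem proposition3p1 (R : realType) (K : topologicalType) (S : set K) (s0 : K)
    (K_compact : compact [set: K]) (K_hausdorff : hausdorff_space K)
    (K_infinite : infinite_set [set: K])
    (S_countable : countable S) (S_infinite : infinite_set S)
    (S_s0 : limit_point S s0) :
  (let X := locally_constant_at R K s0 in
   X `<` [set: continuousType K R] /\
   norm_dense (@sup_norm R K) X /\
   exists X_sublattice : sublattice X,
     [/\ archimedean (subvl X_sublattice),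
         finitely_uniformly_complete (subvl X_sublattice) &
         ~ uniformly_complete (subvl X_sublattice)]) /\
  (let J := locally_zero_at R K s0 in
   ~ norm_closed_in (@sup_norm R K) [set: continuousType K R] J /\
   exists J_ideal : order_ideal J,
     let Z := quotvl J_ideal in
     ~ archimedean Z /\
     exists Phi : forall n, ('I_n -> Z) -> Hfun R n -> Z,
       function_calculus Phi /\
       forall (m n : nat) (z : 'I_n -> Z) (f : 'I_m -> Hfun R n) (g : Hfun R m),
         (0 < m)%N -> (0 < n)%N ->
         Phi m (fun i => Phi n z (f i)) g = Phi n z (Hcomp g f)).
Proof.
have [g [gs0 g_ge0 gX]] :=
  exists_nonconstant_germ (R := R) s0 S K_compact K_hausdorff S_countable S_s0.
have gJ : ~ locally_zero_at R K s0 g.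
  by move=> [U nU g0]; apply: gX; exists U => //; exists 0.
have approx (f : continuousType K R) (eps : R) : 0 < eps ->
    exists h : continuousType K R,
    (\forall x \near s0, h x = f s0) /\ sup_norm (f - h) < eps.
  move=> eps0; have e2 : 0 < eps / 2 by rewrite divr_gt0.
  have [h [hs fh]] := flatten_near s0 f e2; exists h; split=> //.
  apply: (@le_lt_trans _ _ (eps / 2)); first by apply: (sup_norm_le s0).
  by rewrite ltr_pdivrMr// ltr_pMr// ltr1n.
split=> X; split.
- split=> // TX; apply: gX; exact: TX.
- split; last first.
    exists (sublattice_locally_constant_at s0); split.
    + exact: archimedean_sublattice archimedean_cts.
    + exact: locally_constant_finitely_uniformly_complete.
    + exact: locally_constant_not_uniformly_complete gX.
  apply/seteqP; split=> // f _ eps eps0.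
  have [h [hs fh]] := approx f _ eps0; exists h => //.
  by exists [set x | h x = f s0] => //; exists (f s0).
- move=> cJ; apply: gJ; apply: cJ; split=> // eps eps0.
  have [h [hs gh]] := approx g _ eps0; exists h => //.
  by apply/locally_zero_atP; rewrite -gs0.
- exists (order_ideal_locally_zero_at s0); split.
    exact: germ_not_archimedean gs0 g_ge0 gJ.
  exists (@germ_calculus R K s0); split; first exact: germ_function_calculus.
  by move=> *; exact: germ_calculus_comp.
Qed.
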